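(* Let $f(X)=a_{0}+a_{1}X+\cdots +a_{n}X^{n}\in \mathbb{Z}[X]$, $a_{0}a_{n}\neq 0$. Suppose there exist two distinct prime numbers $p$ and $q$ and an index $j\le n$ with $j>n-\frac{n}{\gcd(\nu _{q}(a_{n}),n)}$ such that (i) $\nu _{p}(a_{0})>0$, $\frac{\nu _{p}(a_{i})}{j-i}>\frac{\nu _{p}(a_{0})}{j}$ for $0<i<j$, and $\nu _{p}(a_{i})=0$ for all $j\le i\le n$; (ii) $\nu _{q}(a_{0})=0$, $\frac{\nu _{q}(a_{i})}{i}\geq\frac{\nu _{q}(a_{n})}{n}$ for all $0<i\le n$, and $\nu _{q}(a_{n})>0$; (iii) $\gcd(\nu _{p}(a_{0}),j)=1$. Then $f$ is irreducible over $\mathbb{Q}$.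
   Context: For a prime $p$ and a nonzero integer $m$, $\nu_p(m)$ is the largest integer $i$ such that $p^i\mid m$; by convention $\nu_p(0)=\infty$ (so lower bounds on $\nu_p(a_i)$ hold automatically when $a_i=0$). *)

(* Defs.v *)
From mathcomp Require Import all_boot all_order all_algebra.
From mathcomp Require Import constructive_ereal.

Set Implicit Arguments.
Unset Strict Implicit.
Unset Printing Implicit Defensive.

Import Order.TTheory GRing.Theory Num.Theory.

Local Open Scope ring_scope.

(* The p-adic valuation of m as a natural number. Since logn p 0 = 0, it is
   meaningful only for m != 0; where m may be 0, use nu. *)
Definition valz (p : nat) (m : int) : nat := logn p `|m|%N.

(* The p-adic valuation with the convention nu p 0 = +oo; it takes values in
   the extended rationals so that it can be divided by positive integers. *)
Definition nu (p : nat) (m : int) : \bar rat :=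
  if m == 0 then +oo%E else ((valz p m)%:R)%:E.

(* Main.v *)
Require Import Defs.
From mathcomp Require Import all_boot all_order all_algebra.
From mathcomp Require Import constructive_ereal.
From mathcomp Require Import zify.

(** Newton polygons in disguise: for a weight [A * nu_p(g_i) + B * i] on the
    nonzero coefficients of [g], the minimal weight is additive under products.
    With the prime [p] and the weight [j * nu_p(g_i) + nu_p(a_0) * i], both
    [a_0] and [a_j] have minimal weight in [f]. If [f = g * h] and
    [p] does not divide [g_i * h_k], where [i + k = j], then [g_0] and [g_i] have
    minimal weight in [g], so [j * nu_p(g_0) = nu_p(a_0) * i]; as
    [gcd(nu_p(a_0), j) = 1], [i] is [0] or [j], hence one factor has degree at
    least [j]. With the prime [q], both end coefficients have minimal weight,
    which makes the degree of every factor a multiple of [n / gcd(nu_q(a_n), n)];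
    the complementary factor has smaller degree than this, hence is constant. *)

Set Implicit Arguments.
Unset Strict Implicit.
Unset Printing Implicit Defensive.

Import Order.TTheory GRing.Theory Num.Theory.

Local Open Scope ring_scope.

Lemma valzM (p : nat) (a b : int) :
  a != 0 -> b != 0 -> valz p (a * b) = (valz p a + valz p b)%N.
Proof. by move=> a0 b0; rewrite /valz abszM lognM ?absz_gt0. Qed.

Lemma dvdz_pexp_valz (p e : nat) (a : int) :
  prime p -> a != 0 -> ((p ^ e)%N%:Z %| a)%Z = (e <= valz p a)%N.
Proof. by move=> pp a0; rewrite dvdzE /= pfactor_dvdn ?absz_gt0. Qed.

(** With v the valuation of [a], [p ^ v.+1] divides [b] but not [a], hence not [a + b], while
    [p ^ v] divides both. In divisibility form the hypothesis admits [b = 0] and passes to sums. *)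
Lemma valzD_gt (p : nat) (a b : int) : prime p -> a != 0 ->
  ((p ^ (valz p a).+1)%N%:Z %| b)%Z ->
  a + b != 0 /\ valz p (a + b) = valz p a.
Proof.
move=> pp a0 db.
have nda : ~~ ((p ^ (valz p a).+1)%N%:Z %| a)%Z by rewrite dvdz_pexp_valz // ltnn.
have ndab : ~~ ((p ^ (valz p a).+1)%N%:Z %| a + b)%Z by rewrite rpredDr.
have ab0 : a + b != 0 by apply: contraNneq ndab => ->; rewrite dvdz0.
split=> //; apply/eqP; rewrite eqn_leq -ltnS ltnNge -!dvdz_pexp_valz //.
have db' : ((p ^ valz p a)%N%:Z %| b)%Z.
  by apply: dvdz_trans db; rewrite dvdzE /= dvdn_exp2l.
have da : ((p ^ valz p a)%N%:Z %| a)%Z by rewrite dvdz_pexp_valz.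
by rewrite ndab; exact: rpredD da db'.
Qed.

(** For [A > 0] the level sets are lines of slope -B/A in the plane of the points (i, nu_p(g_i)), so
    the minimum gives a supporting line of the Newton polygon. [B] is signed because the prime [q]
    calls for [- w]. *)
Definition weight (p : nat) (A B : int) (g : {poly int}) (i : nat) : int :=
  A * (valz p g`_i)%:Z + B * i%:Z.

(** Zero coefficients are excluded, since [valz p 0 = 0] would give them a finite weight. *)
Definition weight_lb (p : nat) (A B : int) (g : {poly int}) (m : int) : Prop :=
  forall k, g`_k != 0 -> m <= weight p A B g k.

Lemma coef_neq0_lt_size (g : {poly int}) (i : nat) : g`_i != 0 -> (i < size g)%N.
Proof. by apply: contraR; rewrite -leqNgt => /(nth_default 0) ->. Qed.

Lemma min_weight_exists (p : nat) (A B : int) (g : {poly int}) : g != 0 ->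
  exists m i, [/\ weight_lb p A B g m, g`_i != 0, weight p A B g i = m
    & forall k, g`_k != 0 -> weight p A B g k = m -> (i <= k)%N].
Proof.
move=> g0.
have Pl : g`_(size g).-1 != 0 by rewrite -[_`_ _]/(lead_coef g) lead_coef_eq0.
case: (arg_minP (P := fun i : 'I_(size g) => g`_i != 0)
  (fun i : 'I_(size g) => weight p A B g i)
  (Pl : g`_(Ordinal (coef_neq0_lt_size Pl)) != 0)) => i Pi mi.
pose P k := (g`_k != 0) && (weight p A B g k == weight p A B g i).
have exP : exists k, P k by exists i; rewrite /P Pi eqxx.
case: (ex_minnP exP) => i0 /andP[gi0 /eqP wi0] min0.
exists (weight p A B g i), i0; split=> // k gk.
  exact: (mi (Ordinal (coef_neq0_lt_size gk)) gk).
by move=> wk; apply: min0; rewrite /P gk wk eqxx.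
Qed.

(* With the least minimizing indices [i] and [k], the term [g_i * h_k] is the only
   one of least valuation in [(g * h)_(i + k)]. *)
Lemma min_weightM (p : nat) (A B : int) (g h : {poly int}) :
    prime p -> 0 < A -> g != 0 -> h != 0 ->
  exists m m' l, [/\ weight_lb p A B g m, weight_lb p A B h m',
    (g * h)`_l != 0 & weight p A B (g * h) l = m + m'].
Proof.
move=> p_prime A_gt0.
move=> /(min_weight_exists p A B)[m [i [mg gi wi min_i]]].
move=> /(min_weight_exists p A B)[m' [k [mh hk wk min_k]]].
exists m, m', (i + k)%N.
have lt_i : (i < (i + k).+1)%N by rewrite ltnS leq_addr.
have gh0 : g`_i * h`_k != 0 by rewrite mulf_neq0.
suff [nz Ev] : (g * h)`_(i + k) != 0 /\ valz p (g * h)`_(i + k) = valz p (g`_i * h`_k).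
  by split=> //; rewrite -wi -wk /weight Ev valzM //; lia.
rewrite coefM (bigD1 (Ordinal lt_i)) //= addKn.
apply: valzD_gt => //; apply: rpred_sum => [[i' /= lt_i' ne_i']].
have {}ne_i' : i' != i by [].
have le_i' : (i' <= i + k)%N by rewrite -ltnS.
have [->|gi'] := eqVneq g`_i' 0; first by rewrite mul0r dvdz0.
have [->|hk'] := eqVneq h`_(i + k - i') 0; first by rewrite mulr0 dvdz0.
rewrite dvdz_pexp_valz ?mulf_neq0 // !valzM //.
(* If [i' < i], the first weight exceeds [m] because [i] is least; if [i' > i], then
   [i + k - i' < k] and the second exceeds [m']. *)
have ineq : m + m' < weight p A B g i' + weight p A B h (i + k - i').
  have := mg _ gi'; have := mh _ hk'; have := min_i _ gi'; have := min_k _ hk'.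
  by lia.
move: ineq; rewrite -wi -wk /weight => ineq.
(* Both index pairs sum to [i + k], so the terms in [B] cancel. *)
have {ineq} : A * ((valz p g`_i)%:Z + (valz p h`_k)%:Z) <
    A * ((valz p g`_i')%:Z + (valz p h`_(i + k - i'))%:Z).
  have Ek : (i + k - i')%N%:Z = i%:Z + k%:Z - i'%:Z by lia.
  by rewrite Ek in ineq; lia.
by rewrite ltr_pM2l //; lia.
Qed.

Lemma poly_neq0_of_coef (g : {poly int}) (i : nat) : g`_i != 0 -> g != 0.
Proof. by apply: contraNneq => ->; rewrite coef0. Qed.

(** No point of the product lies below the segment from (0, 0) to (n, w). The leading coefficient of
    each factor then lies on a line of slope w/n through the origin, so w/n times the degree is an
    integer. *)
Lemma pure_polygon_factor_degree (q n w : nat) (g h : {poly int}) :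
    prime q -> (0 < n)%N -> size (g * h) = n.+1 ->
    (g * h)`_0 != 0 -> valz q (g * h)`_0 = 0%N -> valz q (g * h)`_n = w ->
    (forall i, (g * h)`_i != 0 -> (w * i <= n * valz q (g * h)`_i)%N) ->
  (n %/ gcdn w n %| (size g).-1)%N.
Proof.
move=> qp n0 sgh; rewrite coef0M mulf_eq0 negb_or => /andP[g0 h0].
rewrite valzM // => v0 vn vi.
have gn0 := poly_neq0_of_coef g0; have hn0 := poly_neq0_of_coef h0.
have A0 : 0 < n%:Z by [].
have [m [m' [l [mg mh c0 w0]]]] :=
  @min_weightM q n%:Z (- w%:Z) g h qp A0 gn0 hn0.
(* The constant coefficients have weight 0; together with [mm] this makes both minima 0. *)
have m0 : m <= 0 by have := mg _ g0; rewrite /weight; nia.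
have m'0 : m' <= 0 by have := mh _ h0; rewrite /weight; nia.
have mm : 0 <= m + m' by rewrite -w0 /weight; have := vi _ c0; nia.
have lg : g`_(size g).-1 != 0 by rewrite -[_`_ _]/(lead_coef g) lead_coef_eq0.
have lh : h`_(size h).-1 != 0 by rewrite -[_`_ _]/(lead_coef h) lead_coef_eq0.
have En : n = ((size g).-1 + (size h).-1)%N.
  move: sgh; rewrite size_mul //; move: gn0 hn0; rewrite -!size_poly_gt0.
  by move: (size g) (size h) => [|?] [|?] //= _ _; rewrite addnS => -[->].
have Ew : w = (valz q g`_(size g).-1 + valz q h`_(size h).-1)%N.
  have := lead_coefM g h; rewrite /lead_coef sgh /= => E.
  by rewrite -vn E valzM.
have wg := mg _ lg; have wh := mh _ lh; rewrite /weight in wg wh.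
(* The weights of the two leading coefficients are nonnegative and sum to [n * w - w * n = 0], so
   each is 0. *)
have E : (n * valz q g`_(size g).-1 = w * (size g).-1)%N by nia.
set d := gcdn w n.
have d0 : (0 < d)%N by rewrite gcdn_gt0 n0 orbT.
have dn : (n = n %/ d * d)%N by rewrite divnK // dvdn_gcdr.
have dw : (w = w %/ d * d)%N by rewrite divnK // dvdn_gcdl.
have cop : coprime (n %/ d) (w %/ d).
  rewrite /coprime -(eqn_pmul2r d0) muln_gcdl -dn -dw mul1n gcdnC; exact: eqxx.
rewrite -(Gauss_dvdr _ cop) -(dvdn_pmul2r d0) mulnAC -dn -dw -E.
exact: dvdn_mulr.
Qed.

Lemma dvdz_coefM_sum (d : int) (g h : {poly int}) (j : nat) :
  (forall i, (i <= j)%N -> (d %| g`_i * h`_(j - i))%Z) -> (d %| (g * h)`_j)%Z.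
Proof.
by move=> dv; rewrite coefM; apply: rpred_sum => i _; apply: dv; rewrite -ltnS.
Qed.

(** As [v] and [j] are coprime, the segment from (0, v) to (j, 0) has no lattice point strictly
    inside, so it cannot be split between the factors. *)
Lemma eisenstein_dumas_factor_degree (p j v : nat) (g h : {poly int}) :
    prime p -> (0 < j)%N -> coprime v j ->
    (g * h)`_0 != 0 -> valz p (g * h)`_0 = v ->
    (g * h)`_j != 0 -> valz p (g * h)`_j = 0%N ->
    (forall i, (g * h)`_i != 0 -> (v * j <= j * valz p (g * h)`_i + v * i)%N) ->
  (j < size g)%N \/ (j < size h)%N.
Proof.
move=> pp j0 cop; rewrite coef0M mulf_eq0 negb_or => /andP[g0 h0].
rewrite valzM // => v0 fj vj vi.
have gn0 := poly_neq0_of_coef g0; have hn0 := poly_neq0_of_coef h0.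
have A0 : 0 < j%:Z by [].
have [m [m' [l [mg mh c0 w0]]]] := @min_weightM p j%:Z v%:Z g h pp A0 gn0 hn0.
have Pg0 := mg _ g0; have Ph0 := mh _ h0; have Pf := vi _ c0.
rewrite /weight in w0 Pg0 Ph0.
have [i le_ij ndvd] : exists2 i, (i <= j)%N & ~~ (p%:Z %| g`_i * h`_(j - i))%Z.
  have [/existsP[i nd]|/existsPn all_d] :=
    boolP [exists i : 'I_j.+1, ~~ (p%:Z %| g`_i * h`_(j - i))%Z].
    by exists i => //; rewrite -ltnS.
  have : (p%:Z %| (g * h)`_j)%Z.
    apply: dvdz_coefM_sum => i; rewrite -ltnS => lt_i.
    by have := all_d (Ordinal lt_i); rewrite negbK.
  by rewrite -[p]expn1 dvdz_pexp_valz // vj.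
have gi : g`_i != 0 by apply: contraNneq ndvd => ->; rewrite mul0r dvdz0.
have hi : h`_(j - i) != 0 by apply: contraNneq ndvd => ->; rewrite mulr0 dvdz0.
move: ndvd; rewrite -[p]expn1 dvdz_pexp_valz ?mulf_neq0 // valzM // -ltnNge ltnS.
rewrite leqn0 addn_eq0 => /andP[/eqP vg /eqP vh].
have Pgi := mg _ gi; have Phi := mh _ hi.
rewrite /weight vg vh in Pgi Phi.
(* By [Pf], [m + m'] is at least [v * j]; the upper bounds from the indices 0, 0 and from [i],
   [j - i] both sum to [v * j], so all four are equalities. *)
have E : (j * valz p g`_0 = v * i)%N by nia.
have : (j %| i)%N.
  by rewrite -(@Gauss_dvdr j v) 1?coprime_sym // -E dvdn_mulr.
have [i0 _|i0 /(dvdn_leq i0) le_ji] := posnP i.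
  by right; apply: coef_neq0_lt_size; rewrite i0 subn0 in hi.
by left; apply: coef_neq0_lt_size; have <- : i = j by lia.
Qed.

Lemma nu_eq0 (p : nat) (a : int) : nu p a = 0%E -> a != 0 /\ valz p a = 0%N.
Proof.
rewrite /nu; case: eqVneq => // a0 [] /eqP; rewrite pnatr_eq0 => /eqP va.
by [].
Qed.

Lemma nu_divE (p k : nat) (a : int) : a != 0 -> (0 < k)%N ->
  (nu p a / (k%:R)%:E)%E = ((valz p a)%:R / k%:R)%:E.
Proof.
by move=> /negPf a0 k0; rewrite /nu a0 /inve pnatr_eq0 eqn0Ngt k0.
Qed.

Lemma nu_div_le (p k l : nat) (a b : int) :
    a != 0 -> b != 0 -> (0 < k)%N -> (0 < l)%N ->
  (nu p a / (k%:R)%:E <= nu p b / (l%:R)%:E)%E = (valz p a * l <= valz p b * k)%N.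
Proof.
move=> a0 b0 k0 l0; rewrite !nu_divE // lee_fin ler_pdivrMr ?ltr0n // mulrAC.
by rewrite ler_pdivlMr ?ltr0n // -!natrM ler_nat.
Qed.

Theorem theorem1p15 (n : nat) (f : {poly int})
    (size_f : (size f <= n.+1)%N)
    (f0n_neq0 : f`_0 * f`_n != 0)
    (p q : nat) (p_prime : prime p) (q_prime : prime q) (neq_pq : p != q)
    (j : nat) (le_jn : (j <= n)%N)
    (lt_j : (n%:R - n%:R / (gcdn (valz q f`_n) n)%:R : rat) < j%:R)
    (Hi_0 : (0 < nu p f`_0)%E)
    (Hi_lt : forall i : nat, (0 < i < j)%N ->
       (nu p f`_i / (j%:R - i%:R)%:E > nu p f`_0 / (j%:R)%:E)%E)
    (Hi_ge : forall i : nat, (j <= i <= n)%N -> nu p f`_i = 0%E)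
    (Hii_0 : nu q f`_0 = 0%E)
    (Hii_i : forall i : nat, (0 < i <= n)%N ->
       (nu q f`_i / (i%:R)%:E >= nu q f`_n / (n%:R)%:E)%E)
    (Hii_n : (0 < nu q f`_n)%E)
    (Hiii : gcdn (valz p f`_0) j = 1%N) :
  irreducible_poly (map_poly (intr : int -> rat) f).
Proof.
move: (f0n_neq0); rewrite mulf_eq0 negb_or => /andP[f0 fn].
have sf : size f = n.+1.
  by apply/eqP; rewrite eqn_leq size_f coef_neq0_lt_size.
have [_ v0] := nu_eq0 Hii_0.
have n0 : (0 < n)%N.
  by rewrite lt0n; apply: contraTneq Hii_n => ->; rewrite Hii_0 ltxx.
set w := valz q f`_n in lt_j.
set d := gcdn w n in lt_j.
have d0 : (0 < d)%N by rewrite gcdn_gt0 n0 orbT.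
have dn : (n = n %/ d * d)%N by rewrite divnK // dvdn_gcdr.
(* As [d] divides [n], the rational bound on [j] becomes one between natural numbers. *)
have lt_jn : (n < j + n %/ d)%N.
  move: lt_j; rewrite [X in _ - X%:R / _]dn natrM mulfK ?pnatr_eq0 -?lt0n //.
  by rewrite ltrBlDr -natrD ltr_nat.
have j0 : (0 < j)%N.
  by have := leq_div n d; lia.
have [fj vj] : f`_j != 0 /\ valz p f`_j = 0%N by apply: nu_eq0; apply: Hi_ge; rewrite leqnn.
set v := valz p f`_0 in Hiii.
(* For [i >= j] the term [v * i] suffices, at 0 equality holds, and in between this is (i)
   cross-multiplied. *)
have vi i : f`_i != 0 -> (v * j <= j * valz p f`_i + v * i)%N.
  move=> fi; have [lt_ij|] := ltnP i j; last by nia.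
  have [->|i0] := posnP i; first by rewrite /v; lia.
  have ji : (0 < j - i)%N by rewrite subn_gt0.
  have := Hi_lt i; rewrite i0 lt_ij -(natrB _ (ltnW lt_ij)) => /(_ isT).
  by rewrite ltNge nu_div_le // -ltnNge mulnBr -/v => lt_v; lia.
have wi i : f`_i != 0 -> (w * i <= n * valz q f`_i)%N.
  move=> fi; have [->|i0] := posnP i; first by rewrite muln0.
  have le_in : (i <= n)%N by rewrite -ltnS -sf coef_neq0_lt_size.
  have := Hii_i i; rewrite i0 le_in => /(_ isT).
  by rewrite nu_div_le // -/w [X in (_ <= X)%N]mulnC.
have sF : size (map_poly (intr : int -> rat) f) = n.+1.
  by rewrite size_rat_int_poly.
split=> [|g sg dvd_g]; first by rewrite sF ltnS.
(* By Gauss's lemma, a rational divisor is a scalar multiple of an integral one. *)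
have [g1 [a a0 Eg] [h Ef]] := dvdpP_rat_int dvd_g.
have sg1 : size g1 = size g by rewrite Eg size_scale // size_rat_int_poly.
have neq0 : g1 * h != 0 by rewrite -Ef -size_poly_eq0 sf.
move: (neq0); rewrite mulf_eq0 negb_or => /andP[g10 h0].
have sgh : n = ((size g1).-1 + (size h).-1)%N.
  move: sf; rewrite Ef size_mul //; move: g10 h0; rewrite -!size_poly_gt0.
  by move: (size g1) (size h) => [|?] [|?] //= _ _; rewrite addnS => -[->].
have dg : (n %/ d %| (size g1).-1)%N.
  by apply: (@pure_polygon_factor_degree q n w g1 h); rewrite -?Ef.
have dh : (n %/ d %| (size h).-1)%N.
  by apply: (@pure_polygon_factor_degree q n w h g1); rewrite 1?mulrC -?Ef.
have small s : (n %/ d %| s)%N -> (s < n %/ d)%N -> s = 0%N.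
  by case: s => // s /dvdn_leq /= le_s; rewrite ltnNge le_s.
have [jg|jh] : (j < size g1)%N \/ (j < size h)%N.
- by apply: (@eisenstein_dumas_factor_degree p j v); rewrite -?Ef //; apply/eqP.
(* The degree of [h] is at most [n - j < n %/ d]. *)
- have sh : (size h).-1 = 0%N.
    apply: small dh _; rewrite -(ltn_add2l j) (leq_ltn_trans _ lt_jn) // sgh.
    by rewrite leq_add2r -ltnS prednK // (leq_ltn_trans _ jg).
  rewrite -(dvdp_size_eqp dvd_g) sF -sg1 sgh sh addn0 prednK //.
  by rewrite (leq_ltn_trans _ jg).
(* Symmetrically, [g] would be constant, against [sg]. *)
- have s1 : (size g1).-1 = 0%N.
    apply: small dg _; rewrite -(ltn_add2l j) (leq_ltn_trans _ lt_jn) // sgh.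
    by rewrite addnC leq_add2l -ltnS prednK // (leq_ltn_trans _ jh).
  by move: sg; rewrite -sg1 -[size g1]prednK ?s1 ?eqxx // size_poly_gt0.
Qed.
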